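(* Fix integers $d \geq 3$ and $n \geq 2$, and put $a = d-1$ and $q_k = 1 + a + a^2 + \cdots + a^{k-1}$ for $k \geq 1$. Let $T_n$ be the finite rooted tree in which every non-leaf vertex has exactly $d-1$ children and the path from each leaf to the root has exactly $n-1$ edges, and let $\bar{T}_n$ be the multigraph obtained from $T_n$ by identifying all leaves to a single sink vertex $s$ (keeping all edges, so parallel edges to $s$ arise) and adding one extra edge from the root to $s$. Then the sandpile group of $\bar{T}_n$ (with sink $s$) satisfies \[ SP(\bar{T}_n) \simeq \mathbb{Z}/q_n\mathbb{Z} \;\oplus\; \bigoplus_{k=2}^{n-1} \bigl(\mathbb{Z}/q_k\mathbb{Z}\bigr)^{a^{n-1-k}(a-1)}, \] i.e. $SP(\bar{T}_n) \simeq \mathbb{Z}_{1+a}^{a^{n-3}(a-1)} \oplus \mathbb{Z}_{1+a+a^2}^{a^{n-4}(a-1)} \oplus \cdots \oplus \mathbb{Z}_{1+a+\cdots+a^{n-2}}^{a-1} \oplus \mathbb{Z}_{1+a+\cdots+a^{n-1}}$, where $\mathbb{Z}_m^q$ denotes the direct sum of $q$ copies of $\mathbb{Z}/m\mathbb{Z}$ (for $n=2$ the sum over $k$ is empty).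
   Context: For a finite connected multigraph $G$ (multiple edges allowed, no loops) with vertices $x_1,\dots,x_N$ and a distinguished sink vertex $x_N$, the reduced Laplacian $\Delta$ is the $(N-1)\times(N-1)$ integer matrix with $\Delta_{ii} = -\deg(x_i)$ and $\Delta_{ij} = $ number of edges between $x_i$ and $x_j$ for $i \neq j$. The sandpile group is $SP(G) = \mathbb{Z}^{N-1}/\Delta\mathbb{Z}^{N-1}$. *)

(* Defs.v *)
From HB Require Import structures.
From mathcomp Require Import all_boot all_order all_algebra.
From mathcomp Require Import boolp.

Set Implicit Arguments.
Unset Strict Implicit.
Unset Printing Implicit Defensive.

Import GRing.Theory.
Local Open Scope ring_scope.

Definition zmod_isomorphic (A B : zmodType) : Prop :=
  exists f : {additive A -> B}, bijective f.

(* MathComp gives [{dffun forall i, V i}] a (multiplicative) finite group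
   structure only; this is the additive group of a finite direct sum. *)
Section DffunZmod.
Variables (I : finType) (V : I -> zmodType).
Implicit Types f g : {dffun forall i, V i}.

Definition dffun_zero : {dffun forall i, V i} := [ffun i => 0 : V i].
Definition dffun_opp f : {dffun forall i, V i} := [ffun i => - f i : V i].
Definition dffun_add f g : {dffun forall i, V i} :=
  [ffun i => f i + g i : V i].

Fact dffun_addA : associative dffun_add.
Proof. by move=> f g h; apply/ffunP=> i; rewrite !ffunE addrA. Qed.
Fact dffun_addC : commutative dffun_add.
Proof. by move=> f g; apply/ffunP=> i; rewrite !ffunE addrC. Qed.
Fact dffun_add0 : left_id dffun_zero dffun_add.
Proof. by move=> f; apply/ffunP=> i; rewrite !ffunE add0r. Qed.
Fact dffun_addN : left_inverse dffun_zero dffun_opp dffun_add.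
Proof. by move=> f; apply/ffunP=> i; rewrite !ffunE addNr. Qed.

HB.instance Definition _ := GRing.isZmodule.Build {dffun forall i, V i}
  dffun_addA dffun_addC dffun_add0 dffun_addN.
End DffunZmod.

(* The subgroup A Z^n of Z^m; Z^m consists of column vectors. *)
Section ColumnLattice.
Variables (m n : nat) (A : 'M[int]_(m, n)).

Definition col_lattice : {pred 'cV[int]_m} :=
  [pred v | `[< exists w : 'cV[int]_n, v = A *m w >]].

Fact col_lattice_zmod_closed : zmod_closed col_lattice.
Proof.
split=> [|v w /asboolP[v' ->] /asboolP[w' ->]]; apply/asboolP.
  by exists 0; rewrite mulmx0.
by exists (v' - w'); rewrite mulmxBr.
Qed.

HB.instance Definition _ :=
  GRing.isZmodClosed.Build 'cV[int]_m col_lattice col_lattice_zmod_closed.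

Definition coker : zmodType := Quotient.quot col_lattice.
End ColumnLattice.

(* An edge is the unordered pair of its ends: all notions below are invariant
   under swapping the two components of [ends e]. *)
Record multigraph := Multigraph {
  vertex : finType;
  edge : finType;
  ends : edge -> vertex * vertex }.

Section Multigraph.
Variable G : multigraph.
Implicit Types (x y s : vertex G) (e : edge G).

Definition joins e x y := (ends e == (x, y)) || (ends e == (y, x)).

Definition edge_mult x y : nat := #|[set e | joins e x y]|.

(* Loops would be counted once; see [loopless]. *)
Definition degree x : nat :=
  #|[set e | (x == (ends e).1) || (x == (ends e).2)]|.

Definition loopless : Prop := forall e, (ends e).1 != (ends e).2.

Definition connected : Prop :=
  forall x y, connect [rel u v | [exists e, joins e u v]] x y.

(* The non-sink vertices are numbered by [enum_val] on [predC1 s]. *)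
Definition reduced_laplacian s : 'M[int]_(#|predC1 s|) :=
  \matrix_(i, j)
    if i == j then - (degree (enum_val i))%:Z
    else (edge_mult (enum_val i) (enum_val j))%:Z.

Definition sandpile_group s : zmodType := coker (reduced_laplacian s).
End Multigraph.

(* The edges are the pairs {tparent v, v} for v != troot; the value of
   [tparent] at the root is a convention. *)
Record rooted_tree := RootedTree {
  tvertex : finType;
  troot : tvertex;
  tparent : tvertex -> tvertex;
  tparent_root : tparent troot = troot;
  tparent_reach : forall v, exists k, iter k tparent v == troot }.

Section RootedTree.
Variable T : rooted_tree.
Implicit Types v w : tvertex T.

Definition children v : {set tvertex T} :=
  [set w | (w != troot T) && (tparent w == v)].

Definition leaf v : bool := children v == set0.

(* The number of edges on the path from v to the root. *)
Definition depth v : nat := ex_minn (tparent_reach v).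

(* All leaves are identified to the vertex [None]: [insub v] is [None] if v is
   a leaf and [Some] of v otherwise.  The edge [Some v] comes from the tree
   edge {tparent v, v}; [None] is the extra edge from the root to the sink. *)
Definition collapse_leaves : multigraph :=
  @Multigraph (option {v : tvertex T | ~~ leaf v})
    (option {v : tvertex T | v != troot T})
    (fun e => if e is Some v then (insub (tparent (val v)), insub (val v))
              else (insub (troot T), None)).

Definition sink : vertex collapse_leaves := None.
End RootedTree.

Definition regular_tree (d n : nat) (T : rooted_tree) : Prop :=
  (forall v : tvertex T, ~~ leaf v -> #|children v| = (d - 1)%N) /\
  (forall v : tvertex T, leaf v -> depth v = (n - 1)%N).

Definition q (a k : nat) : nat := (\sum_(i < k) a ^ i)%N.

(* [regular_tree] is satisfiable, and the collapsed graph is indeed a connected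
   multigraph without loops. *)

Section Existence.
Variables (a m : nat).
Let V := m.-bseq 'I_a.

Let Vroot : V := [bseq].
Fact size_behead_bseq (v : V) : (size (behead v) <= m)%N.
Proof.
by rewrite size_behead; apply: leq_trans (leq_pred _) (size_bseq v).
Qed.
Let Vparent (v : V) : V := Bseq (size_behead_bseq v).

Let Vparent_root : Vparent Vroot = Vroot.
Proof. exact: val_inj. Qed.

Let iter_Vparent k (v : V) : iter k Vparent v = drop k v :> seq _.
Proof.
elim: k => [|k IHk]; first by rewrite drop0.
by rewrite iterS /= IHk -drop1 drop_drop.
Qed.

Let Vparent_reach (v : V) : exists k, iter k Vparent v == Vroot.
Proof.
by exists (size v); rewrite -val_eqE /= iter_Vparent drop_size.
Qed.

(* Words of length at most m over 'I_a, the last step from the root first. *)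
Definition word_tree := RootedTree Vparent_root Vparent_reach.

Lemma word_treeP : (0 < a)%N -> regular_tree a.+1 m.+1 word_tree.
Proof.
move=> a_gt0.
have chP (v w : V) :
  (w \in @children word_tree v) = (w != [::] :> seq _) && (behead w == v :> seq _).
  by rewrite inE /= -!val_eqE.
have small (v : V) : (size v < m)%N -> #|@children word_tree v| = a.
  move=> lt_vm; pose f (i : 'I_a) : V := Bseq (lt_vm : (size (i :: v) <= m)%N).
  have f_inj : injective f by move=> i j /(congr1 val)[].
  rewrite -[RHS]card_ord -(card_codom f_inj); apply: eq_card => w.
  rewrite chP; apply/andP/codomP => [[w0 /eqP wv]|[i ->]] //=.
  case: w w0 wv => [[|i w] hw] //= _ wv; exists i.
  by apply: val_inj; rewrite /= wv.
have leafE (v : V) : @leaf word_tree v = (size v == m).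
  rewrite /leaf; have := size_bseq v; rewrite leq_eqVlt => /orP[vm|lt_vm].
    rewrite vm; apply/eqP/setP=> w; rewrite chP [RHS]inE.
    case: w => [[|i w] hw] //=; apply/negbTE/eqP => wv.
    by move: hw; rewrite /= wv (eqP vm) ltnn.
  by rewrite (ltn_eqF lt_vm) -cards_eq0 small // (gtn_eqF a_gt0).
split=> v; rewrite leafE subn1 /=.
  move=> vm; apply: small; by rewrite ltn_neqAle vm size_bseq.
move=> /eqP vm; rewrite /depth; case: ex_minnP => k.
rewrite -val_eqE /= iter_Vparent -size_eq0 size_drop subn_eq0 vm => mk kmin.
apply/eqP; rewrite eqn_leq mk andbT; apply: kmin.
by rewrite -val_eqE /= iter_Vparent drop_oversize ?vm.
Qed.
End Existence.

Lemma regular_tree_exists (d n : nat) :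
  (3 <= d)%N -> (2 <= n)%N -> exists T, regular_tree d n T.
Proof.
case: d n => [//|a] [//|m] a_ge2 _; exists (word_tree a m).
by apply: word_treeP; apply: ltn_trans (_ : 0 < 1)%N a_ge2.
Qed.

Section Collapse.
Variables (d n : nat) (T : rooted_tree).
Hypotheses (n_ge2 : (2 <= n)%N) (hT : regular_tree d n T).

Let root_nonleaf : ~~ leaf (troot T).
Proof.
apply/negP => /hT.2; rewrite /depth; case: ex_minnP => k _ /(_ 0%N (eqxx _)).
by rewrite leqn0 => /eqP-> /esym/eqP; rewrite subn_eq0 leqNgt n_ge2.
Qed.

Let parent_nonleaf v : v != troot T -> ~~ leaf (tparent v).
Proof.
move=> v0; apply/negP => /eqP/setP/(_ v).
by rewrite !inE v0 eqxx.
Qed.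

Let parent_neq v : v != troot T -> tparent v != v.
Proof.
move=> v0; apply/eqP => pv; have [k] := tparent_reach v.
suff -> : iter k (@tparent T) v = v by rewrite (negbTE v0).
by elim: k => //= k ->.
Qed.

Let insub_nonleaf v (h : ~~ leaf v) :
  insub v = Some (Sub v h) :> vertex (collapse_leaves T).
Proof. by rewrite /= insubT. Qed.

Lemma collapse_leaves_loopless : loopless (collapse_leaves T).
Proof.
move=> [[v v0]|] /=; last by rewrite (insub_nonleaf root_nonleaf).
rewrite (insub_nonleaf (parent_nonleaf v0)); case: insubP => //= u _ uv.
by apply/eqP => -[/(congr1 val)] /= e; case/eqP: (parent_neq v0); rewrite e.
Qed.

Lemma collapse_leaves_connected : connected (collapse_leaves T).
Proof.
pose r := [rel u v | [exists e : edge (collapse_leaves T), joins e u v]].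
have r_sym : symmetric r.
  by move=> x y /=; apply: eq_existsb => e; rewrite /joins orbC.
have conn_sym := sym_connect_sym r_sym.
have up (v : tvertex T) :
    connect r (insub v : vertex (collapse_leaves T)) (insub (troot T)).
  have [k] := tparent_reach v; elim: k v => [|k IHk] v; first by move=> /eqP /= ->.
  rewrite iterSr => /IHk; apply: connect_trans.
  have [->|v0] := eqVneq v (troot T); first by rewrite tparent_root.
  apply: connect1; apply/existsP; exists (Some (Sub v v0)).
  by rewrite /joins /= eqxx orbT.
have to_root (x : vertex (collapse_leaves T)) : connect r x (insub (troot T)).
  case: x => [[v v0]|]; first by have := up v; rewrite (insub_nonleaf v0).
  rewrite conn_sym; apply: connect1; apply/existsP; exists None.
  by rewrite /joins /= eqxx.
by move=> x y; apply: connect_trans (to_root x) _; rewrite conn_sym.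
Qed.
End Collapse.

(* Main.v *)
(* Let x_v be the class of the vertex v in the sandpile group, with x_v = 0 for
   a leaf v, let h(v) be the height of v (leaves have height 0), and fix a
   preferred child pref(v) of every non-leaf v.  The relation at v reads
   (a+1) x_v = x_parent(v) + sum of x_c over the children c of v.  Going up from
   the leaves it yields elements G_v with
     x_v = q_h(v) G_v   and   x_parent(v) = q_{h(v)+1} G_v:
   if every child c of v has such a G_c, then the differences
   delta_c = G_c - G_pref(v) are killed by q_h(v), and
     G_v = G_pref(v) - q_{h(v)-1} (sum of delta_c over the children c)
   works because q_{k+1} = 1 + a q_k.  So the group is generated by G_root, killed
   by q_n, and by the delta_c for the non-preferred c, killed by q_{h(c)+1}.
   Conversely, in the direct sum of cyclic groups of these orders the recursion
   can be solved downwards from the root,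
     g_c = g_v + q_h(c) (sum of delta_w over the children w of v) + delta_c,
   and v |-> q_h(v) g_v satisfies the relations of the graph.  The two
   homomorphisms so obtained are inverse to each other. *)
Require Import Defs.
From HB Require Import structures.
From mathcomp Require Import all_boot all_order all_algebra.
From mathcomp Require Import boolp zify.

Import GRing.Theory.

(** * Universal properties of cokernels and of finite sums of cyclic groups *)

Section UniversalProperties.
Local Open Scope ring_scope.
Set Implicit Arguments.
Unset Strict Implicit.

Lemma additive_of (A B : zmodType) (f : A -> B) :
  {morph f : x y / x + y} -> exists g : {additive A -> B}, g =1 f.
Proof.
move=> fD.
have f0 : f 0 = 0 by apply: (addIr (f 0)); rewrite -fD !add0r.
have fN : {morph f : x / - x}.
  by move=> x; apply: (addIr (f x)); rewrite -fD !addNr.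
have fB : zmod_morphism f by move=> x y; rewrite fD fN.
by exists (HB.pack_for {additive A -> B} f (GRing.isZmodMorphism.Build A B f fB)).
Qed.

Section Coker.
Variables (m n : nat) (A : 'M[int]_(m, n)).

Definition coker_gen (i : 'I_m) : coker A := \pi_(coker A)%qT (delta_mx i 0).

Lemma pi_coker (v : 'cV[int]_m) :
  \pi_(coker A)%qT v = \sum_i coker_gen i *~ v i 0.
Proof.
rewrite [in LHS](matrix_sum_delta v) raddf_sum; apply: eq_bigr => i _.
by rewrite big_ord1 -[RHS]raddfMz; congr (\pi_(coker A)%qT _); rewrite -scaler_int intz.
Qed.

Lemma coker_relation (j : 'I_n) : \sum_i coker_gen i *~ A i j = 0.
Proof.
have -> : \sum_i coker_gen i *~ A i j = \pi_(coker A)%qT (col j A).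
  by rewrite pi_coker; apply: eq_bigr => i _; rewrite mxE.
rewrite -[RHS](raddf0 (\pi_(coker A)%qT)); apply/eqP.
rewrite -Quotient.idealrBE subr0; apply/asboolP; exists (delta_mx j 0).
by rewrite colE.
Qed.

Lemma coker_eq_additive (Z : zmodType) (f g : {additive coker A -> Z}) :
  (forall i, f (coker_gen i) = g (coker_gen i)) -> f =1 g.
Proof.
move=> fg x; rewrite -[x]reprK pi_coker !raddf_sum; apply: eq_bigr => i _.
by rewrite !raddfMz fg.
Qed.

(** The combination [F] of the [y i] kills the column lattice, so its value at [repr] does not
    depend on the representative chosen. *)
Lemma coker_lift (Z : zmodType) (y : 'I_m -> Z) :
  (forall j, \sum_i y i *~ A i j = 0) ->
  exists f : {additive coker A -> Z}, forall i, f (coker_gen i) = y i.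
Proof.
move=> yA; pose F (v : 'cV[int]_m) := \sum_i y i *~ v i 0.
have FD : {morph F : u v / u + v}.
  by move=> u v; rewrite -big_split; apply: eq_bigr => i _; rewrite mxE mulrzDr.
have FB u v : F (u - v) = F u - F v.
  by apply: (addIr (F v)); rewrite -FD !subrK.
have Fpi u : F (repr (\pi_(coker A)%qT u)) = F u.
  apply/eqP; rewrite eq_sym -subr_eq0 -FB; apply/eqP.
  have: u - repr (\pi_(coker A)%qT u) \in col_lattice A.
    by rewrite Quotient.idealrBE reprK.
  case/asboolP=> w ->; rewrite /F.
  under eq_bigr => i _ do rewrite mxE mulrz_sumr.
  rewrite exchange_big /= big1 // => j _.
  by under eq_bigr => i _ do rewrite mulrzA; rewrite -mulrz_suml yA mul0rz.
have [|f fE] := @additive_of (coker A) Z (F \o repr).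
  by move=> a b /=; rewrite -FD -[a in LHS]reprK -[b in LHS]reprK -raddfD /= Fpi.
exists f => i; rewrite fE /= Fpi /F (bigD1 i) //= mxE !eqxx mulr1z big1 ?addr0 //.
by move=> k ki; rewrite mxE (negbTE ki).
Qed.
End Coker.

Lemma eq_pair (A B : Type) (x y : A * B) : x.1 = y.1 -> x.2 = y.2 -> x = y.
Proof. by case: x y => [? ?] [? ?] /= -> ->. Qed.

(** Reducing [i + j] modulo [p] removes a multiple of [p], which kills [z]; [1 < p] ensures that
    ['Z_p] has exactly [p] elements. *)
Lemma mulrn_Zp_add (Z : zmodType) (p : nat) (z : Z) (i j : 'Z_p) :
  (1 < p)%N -> z *+ p = 0 -> z *+ (i + j)%R = z *+ i + z *+ j.
Proof.
case: p i j => [|[|p]] i j //= _ zp; rewrite -mulrnDr.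
by rewrite [in RHS](divn_eq (i + j) p.+2) mulrnDr mulnC mulrnA zp mul0rn add0r.
Qed.

Section DffunEval.
Variables (I : finType) (V : I -> zmodType).
Implicit Type f : {dffun forall i, V i}.

Lemma dffun_addE f g i : (f + g) i = f i + g i.
Proof. by rewrite ffunE. Qed.

Lemma dffun_0E i : (0 : {dffun forall i, V i}) i = 0.
Proof. by rewrite ffunE. Qed.

Lemma dffun_mulrnE f n i : (f *+ n) i = f i *+ n.
Proof.
by elim: n => [|n IHn]; rewrite ?mulr0n ?dffun_0E // !mulrS dffun_addE IHn.
Qed.

Lemma dffun_sumE (J : finType) (F : J -> {dffun forall i, V i}) i :
  (\sum_j F j) i = \sum_j F j i.
Proof.
by elim/big_rec2: _ => [|j x y _ <-]; rewrite ?dffun_0E ?dffun_addE.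
Qed.
End DffunEval.

(* The generators of order [Q k] are named by arbitrary elements [idx i] of [V]. *)
Section CyclicSum.
Variables (m : nat) (I : finType) (N Q : I -> nat).
Variables (V : eqType) (idx : forall k, 'I_(N k) -> V).
Hypotheses (m_gt1 : (1 < m)%N) (Q_gt1 : forall k, (1 < Q k)%N).
Hypotheses (idx_inj : forall k, injective (@idx k))
  (idx_disjoint : forall k l (i : 'I_(N k)) (j : 'I_(N l)),
     idx i = idx j -> k = l).
Let M : zmodType :=
  ('Z_m * {dffun forall k : I, {ffun 'I_(N k) -> 'Z_(Q k)}})%type.

Definition first_gen : M := (1, 0).

(** An indicator function, so that it makes sense for every [v]: a standard generator if [v] names a
    summand, and 0 otherwise. *)
Definition idx_gen (v : V) : M :=
  (0, [ffun k => [ffun i : 'I_(N k) => (idx i == v)%:R]]).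

Lemma first_gen_order : first_gen *+ m = 0.
Proof.
apply: eq_pair; first by rewrite [LHS](raddfMn fst) /= pchar_Zp.
by rewrite [LHS](raddfMn snd) /= mul0rn.
Qed.

Lemma idx_gen_order (v : V) (o : nat) :
  (forall k (i : 'I_(N k)), idx i = v -> o = Q k) -> idx_gen v *+ o = 0.
Proof.
move=> oQ; apply: eq_pair; first by rewrite [LHS](raddfMn fst) /= mul0rn.
rewrite [LHS](raddfMn snd) /=; apply/ffunP => k; rewrite dffun_mulrnE !ffunE.
apply/ffunP => i; rewrite ffunMnE !ffunE.
by case: eqP => [/oQ->|_]; rewrite ?mul0rn // pchar_Zp.
Qed.

Lemma idx_gen_eq0 (v : V) :
  (forall k (i : 'I_(N k)), idx i != v) -> idx_gen v = 0.
Proof.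
move=> v_notin; apply: eq_pair => //; apply/ffunP => k; rewrite !ffunE.
by apply/ffunP => i; rewrite !ffunE (negbTE (v_notin k i)).
Qed.

Lemma cyclic_sumE (x : M) :
  x = first_gen *+ x.1 + \sum_k \sum_i idx_gen (@idx k i) *+ (x.2 k i).
Proof.
apply: eq_pair.
  rewrite [RHS](raddfD fst) (raddfMn fst) (raddf_sum fst) /= natr_Zp big1 ?addr0 // => k _.
  by rewrite (raddf_sum fst) big1 // => i _; rewrite (raddfMn fst) /= mul0rn.
rewrite [RHS](raddfD snd) (raddfMn snd) (raddf_sum snd) /= mul0rn add0r.
apply/ffunP => k; rewrite dffun_sumE; apply/ffunP => i; rewrite sum_ffunE.
under eq_bigr => l _ do rewrite (raddf_sum snd) dffun_sumE sum_ffunE.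
have genE l j : ((idx_gen (@idx l j) *+ x.2 l j).2 k) i =
    (@idx k i == @idx l j)%:R *+ x.2 l j.
  by rewrite (raddfMn snd) dffun_mulrnE ffunMnE /= !ffunE.
rewrite (bigD1 k) //= (bigD1 i) //= genE eqxx natr_Zp.
rewrite big1 => [|j ji]; last first.
  by rewrite genE (inj_eq (@idx_inj k)) eq_sym (negbTE ji) mul0rn.
rewrite big1 ?addr0 // => l lk; apply: big1 => j _; rewrite genE.
by case: eqP => [/idx_disjoint/esym/eqP|_]; rewrite ?mul0rn // (negbTE lk).
Qed.

Lemma cyclic_sum_eq_additive (Z : zmodType) (f g : {additive M -> Z}) :
  f first_gen = g first_gen ->
  (forall k (i : 'I_(N k)), f (idx_gen (idx i)) = g (idx_gen (idx i))) ->
  f =1 g.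
Proof.
move=> fg0 fg x; rewrite [x]cyclic_sumE !raddfD !raddfMn fg0; congr (_ + _).
rewrite !raddf_sum; apply: eq_bigr => k _; rewrite !raddf_sum.
by apply: eq_bigr => i _; rewrite !raddfMn fg.
Qed.

Lemma cyclic_sum_lift (Z : zmodType) (z0 : Z) (z : V -> Z) :
  z0 *+ m = 0 -> (forall k (i : 'I_(N k)), z (idx i) *+ Q k = 0) ->
  exists f : {additive M -> Z}, f first_gen = z0 /\
    forall k (i : 'I_(N k)), f (idx_gen (idx i)) = z (idx i).
Proof.
move=> z0m zQ.
have [|f fE] := @additive_of M Z
  (fun x => z0 *+ x.1 + \sum_k \sum_i z (@idx k i) *+ (x.2 k i)).
  move=> x y /=; rewrite mulrn_Zp_add // -!addrA; congr (_ + _).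
  rewrite addrCA; congr (_ + _); rewrite -big_split; apply: eq_bigr => k _.
  rewrite -big_split; apply: eq_bigr => i _.
  by rewrite dffun_addE ffunE mulrn_Zp_add.
exists f; split=> [|k i]; rewrite fE /=.
  rewrite mulr1n big1 ?addr0 // => k _.
  by apply: big1 => i _; rewrite !ffunE.
rewrite mulr0n add0r (bigD1 k) //= (bigD1 i) //= !ffunE eqxx /=.
rewrite mulr1n.
rewrite big1 => [|j ji]; last by rewrite !ffunE (inj_eq (@idx_inj k)) (negbTE ji).
rewrite big1 ?addr0 // => l lk; apply: big1 => j _; rewrite !ffunE.
by case: eqP => [/idx_disjoint/eqP|//]; rewrite (negbTE lk).
Qed.
End CyclicSum.
End UniversalProperties.

(** * Depth, height and counting in the tree *)

Section RootedTrees.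
Local Open Scope nat_scope.
Set Implicit Arguments.
Unset Strict Implicit.
Variables (T : rooted_tree) (a n : nat).
Hypothesis n_gt1 : 1 < n.
Hypothesis card_children : forall v : tvertex T, ~~ leaf v -> #|children v| = a.
Hypothesis depth_leaf : forall v : tvertex T, leaf v -> depth v = n - 1.
Implicit Types v w c : tvertex T.

Lemma iter_depth v : iter (depth v) (@tparent T) v = troot T.
Proof. by rewrite /depth; case: ex_minnP => k /eqP. Qed.

Lemma depth_eq0 v : (depth v == 0) = (v == troot T).
Proof.
apply/eqP/eqP => [dv|->]; first by have := iter_depth v; rewrite dv.
by rewrite /depth; case: ex_minnP => k _ /(_ 0 (eqxx _)); rewrite leqn0 => /eqP.
Qed.

Lemma depth_tparent v : v != troot T -> depth v = (depth (tparent v)).+1.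
Proof.
move=> v0; apply/eqP; rewrite eqn_leq; apply/andP; split.
  rewrite {1}/depth; case: ex_minnP => k _; apply.
  by rewrite iterSr iter_depth.
have := v0; rewrite -depth_eq0 -lt0n => dv_gt0.
rewrite -(prednK dv_gt0) ltnS {1}/depth; case: ex_minnP => k _; apply.
by rewrite -iterSr prednK ?iter_depth.
Qed.

Lemma childrenP v c : reflect (c != troot T /\ tparent c = v) (c \in children v).
Proof. by rewrite inE; apply: (iffP andP) => -[? /eqP]. Qed.

Lemma tparent_nleaf v : v != troot T -> ~~ leaf (tparent v).
Proof.
by move=> v0; apply/set0Pn; exists v; apply/childrenP.
Qed.

Lemma nleaf_child v : ~~ leaf v -> exists c, c \in children v.
Proof. by move/set0Pn. Qed.

(** A vertex of maximal depth has no child, hence is a leaf. *)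
Lemma depth_le v : depth v <= n - 1.
Proof.
have [w _ wmax] := @arg_maxnP _ v xpredT (@depth T) isT.
apply: leq_trans (wmax v isT) _; have [/depth_leaf->//|] := boolP (leaf w).
case/nleaf_child=> c /childrenP[c0 pc]; have := wmax c isT.
by rewrite (depth_tparent c0) pc; lia.
Qed.

Definition height v := n - 1 - depth v.

Lemma height_root : height (troot T) = n - 1.
Proof. by rewrite /height (eqP (etrans (depth_eq0 _) (eqxx _))) subn0. Qed.

Lemma height_tparent v : v != troot T -> height (tparent v) = (height v).+1.
Proof.
by move=> v0; rewrite /height; have := depth_le v; rewrite depth_tparent // => ?; lia.
Qed.

Lemma height_eq0 v : (height v == 0) = leaf v.
Proof.
apply/idP/idP => [/eqP hv|/depth_leaf dv]; last by rewrite /height dv subnn.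
apply/negPn/negP => /nleaf_child[c /childrenP[c0 pc]].
by have := height_tparent c0; rewrite pc hv.
Qed.

Lemma leaf_root : leaf (troot T) = false.
Proof. by rewrite -height_eq0 height_root subn_eq0 leqNgt n_gt1. Qed.

Definition pref v := odflt v [pick c in children v].

Lemma pref_child v : ~~ leaf v -> pref v \in children v.
Proof.
rewrite /pref; case: pickP => //= nch /nleaf_child[c]; by rewrite nch.
Qed.

(** Double counting of the parent-child pairs between consecutive levels. *)
Lemma card_level j : j < n -> #|[set v : tvertex T | depth v == j]| = a ^ j.
Proof.
elim: j => [|j IHj] ltjn.
  by rewrite -[RHS](cards1 (troot T)); apply: eq_card => v; rewrite !inE depth_eq0.
rewrite expnS -IHj 1?ltnW // mulnC -sum_nat_const.
rewrite (eq_bigr (fun v => \sum_(c in children v) 1)) => [|v]; last first.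
  rewrite inE => /eqP dv; rewrite sum1_card card_children //.
  apply/negP => /depth_leaf; rewrite dv; lia.
rewrite (exchange_big_dep (mem [set c : tvertex T | depth c == j.+1])) /=.
  rewrite -sum1_card; apply: eq_bigr => c; rewrite inE => /eqP dc.
  have c0 : c != troot T by rewrite -depth_eq0 dc.
  rewrite (big_pred1 (tparent c)) // => v /=; rewrite !inE c0 /= [v == _]eq_sym.
  by case: (tparent c =P v) => [<-|]; rewrite ?andbF // -eqSS -depth_tparent // dc eqxx.
move=> v c; rewrite !inE => /eqP <- /andP[c0 /eqP <-].
by rewrite depth_tparent.
Qed.

(* These vertices index the summands [Z/q_k] when [k >= 2]. *)
Definition secondary k : {set tvertex T} :=
  [set c | [&& c != troot T, c != pref (tparent c) & (height c).+1 == k]].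

(** The parents of these vertices are the [a ^ (n - 1 - k)] vertices of height [k], each with
    [a - 1] non-preferred children. *)
Lemma card_secondary k : 2 <= k < n -> #|secondary k| = a ^ (n - 1 - k) * (a - 1).
Proof.
case/andP=> k2 kn; rewrite -card_level; last by lia.
rewrite -sum_nat_const.
rewrite (eq_bigr (fun v => \sum_(c in children v :\ pref v) 1)) => [|v]; last first.
  rewrite inE => /eqP dv; have vn : ~~ leaf v.
    by apply/negP => /depth_leaf; rewrite dv; lia.
  rewrite sum1_card -(card_children vn) (cardsD1 (pref v) (children v)).
  by rewrite pref_child // add1n subn1.
rewrite (exchange_big_dep (mem (secondary k))) /=.
  rewrite -sum1_card; apply: eq_bigr => c; rewrite inE => /and3P[c0 cp /eqP hc].
  rewrite (big_pred1 (tparent c)) // => v /=; rewrite !inE c0 /= [v == _]eq_sym.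
  case: (tparent c =P v) => [<-|]; rewrite ?andbF // cp /= andbT.
  by have := height_tparent c0; have := depth_le (tparent c); rewrite hc /height; lia.
move=> v c; rewrite !inE => /eqP dv /and3P[cp c0 /eqP pc].
rewrite c0 pc cp -height_tparent // pc /height dv; lia.
Qed.
End RootedTrees.

(** * The reduced Laplacian of the collapsed tree *)

Section Laplacian.
Local Open Scope ring_scope.
Set Implicit Arguments.
Unset Strict Implicit.
Variables (T : rooted_tree) (a n : nat).
Hypotheses (n_gt1 : (1 < n)%N).
Hypothesis card_children : forall v : tvertex T, ~~ leaf v -> #|children v| = a.
Hypothesis depth_leaf : forall v : tvertex T, leaf v -> depth v = (n - 1)%N.
Implicit Types u v w c : tvertex T.
Let G := collapse_leaves T.
(** Every leaf becomes the sink [None]; likewise [parent_edge] sends the root to the extra edge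
    [None]. *)
Let node v : vertex G := insub v.
Let parent_edge v : edge G := insub v.

Let node_eq u v : ~~ leaf u -> (node u == node v) = (u == v).
Proof.
move=> ul; rewrite /node [insub u]insubT; apply/eqP/eqP => [|<-]; last by rewrite insubT.
by case: insubP => // w _ <- [<-].
Qed.

Let node_none u : ~~ leaf u -> (node u == None) = false.
Proof. by move=> ul; rewrite /node insubT. Qed.

Let tparent_neq v : v != troot T -> (tparent v == v) = false.
Proof.
by move=> v0; apply/eqP => pv; have := depth_tparent v0; rewrite pv; lia.
Qed.

Lemma card_edges (P : pred (edge G)) :
  #|[set e | P e]| = (P None + #|[set w | (w != troot T) && P (parent_edge w)]|)%N.
Proof.
rewrite (cardsD1 None) inE; congr (_ + _)%N.
rewrite -(card_in_imset (f := parent_edge)) => [|u v]; last first.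
  rewrite !inE => /andP[u0 _] /andP[v0 _]; rewrite /parent_edge.
  by rewrite [insub u]insubT [insub v]insubT => -[].
apply: eq_card => e; rewrite !inE; apply/andP/imsetP => [[]|[w]].
  case: e => [[w w0]|] //= _ Pw; exists w; last by rewrite /parent_edge insubT.
  by rewrite inE w0 /parent_edge insubT.
by rewrite inE => /andP[w0 Pw] ->; split=> //; rewrite /parent_edge insubT.
Qed.

Lemma ends_parent_edge w : w != troot T ->
  ends (parent_edge w) = (node (tparent w), node w).
Proof. by move=> w0; rewrite /parent_edge insubT. Qed.

Lemma degree_node v : ~~ leaf v -> degree (node v) = a.+1.
Proof.
move=> vl; rewrite /degree card_edges /= node_eq // node_none // orbF.
rewrite -(card_children vl).
(* Tree edges are named by their lower ends: those at [v] are its children and, off the root, [v]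
   itself. At the root the extra edge makes up for the latter. *)
have -> : [set w | (w != troot T) &&
    ((node v == (ends (parent_edge w)).1) || (node v == (ends (parent_edge w)).2))]
    = children v :|: (if v == troot T then set0 else [set v]).
  apply/setP => w; rewrite !inE; have [->|w0] := eqVneq w (troot T).
    by rewrite /=; case: (eqVneq v (troot T)) => v0; rewrite !inE // eq_sym (negbTE v0).
  rewrite ends_parent_edge // !node_eq // [v == tparent w]eq_sym.
  congr (_ || _).
  by case: (eqVneq v (troot T)) => [->|_]; rewrite inE eq_sym // (negbTE w0).
rewrite cardsU; case: eqP => [v0|/eqP v0].
  by rewrite setI0 cards0 addn0 subn0 add1n.
rewrite disjoint_setI0 ?cards0 ?cards1 ?subn0 ?addn1 //.
by rewrite disjoint_sym disjoints1 inE v0 tparent_neq.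
Qed.

Lemma edge_mult_node u v : ~~ leaf u -> ~~ leaf v ->
  edge_mult (node u) (node v) =
    ((v != troot T) && (tparent v == u) + (u != troot T) && (tparent u == v))%N.
Proof.
move=> ul vl; rewrite /edge_mult card_edges /joins /=.
rewrite !xpair_eqE ![None == _]eq_sym !node_none // !andbF add0n.
(* The parent edge of [x], named by [x], provided that it leads to [y]. *)
pose S x y := [set w | [&& w == x, x != troot T & tparent x == y]].
have cardS x y : #|S x y| = ((x != troot T) && (tparent x == y)).
  case: andP => [[x0 /eqP pxy]|nxy].
    by rewrite -[RHS](cards1 x); apply: eq_card => w; rewrite !inE x0 pxy eqxx !andbT.
  by apply: eq_card0 => w; rewrite !inE; apply/and3P => -[*]; apply: nxy.
have -> : [set w | (w != troot T) && ((ends (parent_edge w) == (node u, node v)) ||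
    (ends (parent_edge w) == (node v, node u)))] = S v u :|: S u v.
  apply/setP => w; rewrite !inE; have [->|w0] := eqVneq w (troot T).
    by rewrite /= ![troot T == _]eq_sym; case: (v == troot T); case: (u == troot T).
  rewrite ends_parent_edge // !xpair_eqE ![_ == node u]eq_sym ![_ == node v]eq_sym.
  rewrite !node_eq // ![u == _]eq_sym ![v == _]eq_sym.
  by congr (_ || _); rewrite andbC; (case: eqP => [e|//]; rewrite -e ?[troot T == w]eq_sym w0).
rewrite cardsU !cardS disjoint_setI0 ?cards0 ?subn0 //.
apply/pred0P => w /=; rewrite !inE.
apply/negP => /andP[/and3P[/eqP-> v0 /eqP pv] /and3P[/eqP uv _ _]].
by have := tparent_neq v0; rewrite pv uv eqxx.
Qed.

(** [troot T] is only a default value: [enum_val i] is never the sink. *)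
Definition index_vertex (i : 'I_#|predC1 (sink T)|) : tvertex T :=
  if enum_val i is Some u then val u else troot T.

Lemma node_index i : node (index_vertex i) = enum_val i.
Proof.
rewrite /index_vertex; have := enum_valP i; rewrite inE.
by case: (enum_val i) => [[u ul]|] //= _; rewrite /node insubT.
Qed.

Lemma index_nleaf i : ~~ leaf (index_vertex i).
Proof.
have := enum_valP i; rewrite inE -node_index /node /=.
by case: insubP.
Qed.

Lemma index_vertexP v : ~~ leaf v -> exists i, index_vertex i = v.
Proof.
move=> vl; have v_in : node v \in predC1 (sink T) by rewrite inE node_none.
exists (enum_rank_in v_in (node v)); apply/eqP.
by rewrite -node_eq ?index_nleaf // node_index enum_rankK_in.
Qed.

Lemma index_vertex_inj : injective index_vertex.
Proof. by move=> i j /(congr1 node); rewrite !node_index => /enum_val_inj. Qed.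

(** No vertex is its own parent, so both adjacency terms vanish on the diagonal and one formula
    covers all entries. *)
Lemma reduced_laplacianE i j (u := index_vertex i) (v := index_vertex j) :
  reduced_laplacian (sink T) i j =
    ((v != troot T) && (tparent v == u))%:Z +
    ((u != troot T) && (tparent u == v))%:Z - ((u == v) * a.+1)%N%:Z.
Proof.
rewrite mxE -!node_index -/u -/v -(inj_eq index_vertex_inj) -/u -/v.
rewrite edge_mult_node ?degree_node ?index_nleaf //.
case: eqP => [->|_]; last by rewrite subr0 PoszD.
by case: eqP => [|/eqP/tparent_neq->]; rewrite ?andbF mul1n ?add0r.
Qed.

(* The sink, where the parent edge of the root ends, contributes 0. *)
Definition to_tparent (Z : zmodType) (y : tvertex T -> Z) v : Z :=
  if v == troot T then 0 else y (tparent v).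

(** These are the families of values that homomorphisms from the sandpile group to [Z] take at the
    vertices. *)
Definition harmonic (Z : zmodType) (y : tvertex T -> Z) : Prop :=
  (forall v, leaf v -> y v = 0) /\
  (forall v, ~~ leaf v -> y v *+ a.+1 = to_tparent y v + \sum_(c in children v) y c).

(** As [y] vanishes on leaves, the sum over non-sink indices extends to all vertices, where the
    three terms of an entry are summed separately. *)
Lemma sum_laplacian (Z : zmodType) (y : tvertex T -> Z) j (v := index_vertex j) :
  (forall w, leaf w -> y w = 0) ->
  \sum_i y (index_vertex i) *~ reduced_laplacian (sink T) i j =
    to_tparent y v + \sum_(c in children v) y c - y v *+ a.+1.
Proof.
move=> yleaf.
pose L u : int := ((v != troot T) && (tparent v == u))%:Z +
    ((u != troot T) && (tparent u == v))%:Z - ((u == v) * a.+1)%N%:Z.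
have -> : \sum_i y (index_vertex i) *~ reduced_laplacian (sink T) i j =
    \sum_u y u *~ L u.
  under eq_bigr do rewrite reduced_laplacianE -/v -/(L _).
  rewrite [RHS](bigID (fun u => leaf u)) /= [X in _ = X + _]big1 ?add0r => [|u ul]; last first.
    by rewrite yleaf // mul0rz.
  rewrite (reindex_onto index_vertex (fun u => odflt j [pick i | index_vertex i == u])) /=.
    apply: eq_bigl => i; rewrite index_nleaf /=.
    by case: pickP => [k /eqP/index_vertex_inj->|/(_ i)] /=; rewrite eqxx.
  move=> u /index_vertexP[i <-].
  by case: pickP => [k /eqP|/(_ i)] //=; rewrite eqxx.
rewrite /L; under eq_bigr do rewrite mulrzBr mulrzDr -!pmulrn.
rewrite big_split sumrN big_split /=; congr (_ + _ - _).
- rewrite /to_tparent; case: eqP => [_|_] /=; first by apply: big1 => u _; rewrite mulr0n.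
  rewrite (bigD1 (tparent v)) //= eqxx mulr1n big1 ?addr0 // => u.
  by rewrite eq_sym => /negbTE->.
- rewrite [RHS]big_mkcond; apply: eq_bigr => u _; rewrite inE; by case: ifP.
- rewrite (bigD1 v) //= eqxx mul1n big1 ?addr0 // => u /negbTE->.
  by rewrite mul0n mulr0n.
Qed.
End Laplacian.

(** * The numbers [q_k] and their recursion *)

Section Repunits.
Local Open Scope nat_scope.

Lemma q0 (a : nat) : q a 0 = 0.
Proof. exact: big_ord0. Qed.

Lemma qS (a k : nat) : q a k.+1 = 1 + a * q a k.
Proof.
rewrite /q big_ord_recl expn0 big_distrr; congr addn.
by apply: eq_bigr => i _; rewrite expnS.
Qed.

Lemma q_gt1 (a k : nat) : 0 < a -> 1 < k -> 1 < q a k.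
Proof. by case: k => [|[|k]] // a_gt0 _; rewrite !qS; nia. Qed.
End Repunits.

(** * Recursions down from the root and up from the leaves *)

Section Splitting.
Local Open Scope ring_scope.
Set Implicit Arguments.
Unset Strict Implicit.
Variables (T : rooted_tree) (a n : nat).
Hypotheses (a_gt0 : (0 < a)%N) (n_gt1 : (1 < n)%N).
Hypothesis card_children : forall v : tvertex T, ~~ leaf v -> #|children v| = a.
Hypothesis depth_leaf : forall v : tvertex T, leaf v -> depth v = (n - 1)%N.
Implicit Types v w c : tvertex T.
Local Notation h := (height n).

Let height_p : forall v, v != troot T -> h (tparent v) = (h v).+1.
Proof. exact: height_tparent. Qed.

Let height_0 : forall v, (h v == 0)%N = leaf v.
Proof. exact: height_eq0. Qed.

Let leaf0 : leaf (troot T) = false.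
Proof. exact: (leaf_root n_gt1). Qed.

Let leaf_nroot v : leaf v -> v != troot T.
Proof. by move=> vl; apply: contraTneq vl => ->; rewrite leaf0. Qed.

Let height_child v c : c \in children v -> h v = (h c).+1.
Proof. by case/childrenP=> c0 <-; exact: height_p. Qed.

Let pref_in v : ~~ leaf v -> pref v \in children v.
Proof. exact: pref_child. Qed.

Let q_height_root : q a (h (troot T)).+1 = q a n.
Proof. by rewrite height_root // subn1 prednK // ltnW. Qed.

(* The relations between the generators of the direct sum of cyclic groups:
   [del c] generates the summand of a non-preferred child [c]. *)
Definition frame (Z : zmodType) (gam : Z) (del : tvertex T -> Z) : Prop :=
  [/\ gam *+ q a n = 0, forall c, del c *+ q a (h c).+1 = 0,
      del (troot T) = 0 & forall v, ~~ leaf v -> del (pref v) = 0].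

(** At height 0 the order relation has the factor [q a 1 = 1]. *)
Lemma frame_leaf (Z : zmodType) gam del v : @frame Z gam del -> leaf v -> del v = 0.
Proof.
case=> _ delq _ _; rewrite -height_0 => /eqP hv.
by have := delq v; rewrite hv qS q0 muln0.
Qed.

Lemma top_down (Z : zmodType) (gam : Z) (e : tvertex T -> Z) :
  exists g : tvertex T -> Z, g (troot T) = gam /\
    forall c, c != troot T -> g c = g (tparent c) + e c.
Proof.
(* The increments [e] are added up along the path to the root. *)
exists (fun v => gam + \sum_(i < depth v) e (iter i (@tparent T) v)); split.
  by rewrite (eqP (etrans (depth_eq0 _) (eqxx _))) big_ord0 addr0.
move=> c c0; rewrite (depth_tparent c0) big_ord_recl /= -addrA; congr (_ + _).
by rewrite addrC; congr (_ + _); apply: eq_bigr => i _; rewrite -iterS iterSr.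
Qed.

(** [F v] looks only at children, all of height exactly one less, so [h v] rounds of the recursion
    determine the value at [v]. *)
Lemma bottom_up (Z : zmodType) (y : tvertex T -> Z)
    (F : tvertex T -> (tvertex T -> Z) -> Z) :
  (forall v g1 g2, ~~ leaf v -> {in children v, g1 =1 g2} -> F v g1 = F v g2) ->
  exists g : tvertex T -> Z, (forall v, leaf v -> g v = y v) /\
    (forall v, ~~ leaf v -> g v = F v g).
Proof.
move=> F_ext.
pose G := fix G k := if k is k'.+1 then fun v => F v (G k') else y.
exists (fun v => G (h v) v); split=> v.
  by rewrite -height_0 => /eqP ->.
move=> vl; case hv: (h v) (vl) => [|k] /=; first by rewrite -height_0 hv.
move=> _; apply: F_ext => // c cv.
by move: (height_child cv); rewrite hv => -[->].
Qed.

Lemma harmonic_of_frame (Z : zmodType) (gam : Z) (del : tvertex T -> Z) :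
  frame gam del ->
  exists g : tvertex T -> Z,
    [/\ g (troot T) = gam,
        forall v c, c \in children v ->
          g c = g v + (\sum_(w in children v) del w) *+ q a (h c) + del c
      & harmonic a (fun v => g v *+ q a (h v))].
Proof.
move=> fr; have [gamq delq del0 delp] := fr.
have [g [g0 gc]] := top_down gam (fun c =>
  (\sum_(w in children (tparent c)) del w) *+ q a (h c) + del c).
have gE v c : c \in children v ->
    g c = g v + (\sum_(w in children v) del w) *+ q a (h c) + del c.
  by case/childrenP=> c0 <-; rewrite gc // addrA.
exists g; split=> //.
have sumq v : (\sum_(w in children v) del w) *+ q a (h v) = 0.
  by rewrite -sumrMnl big1 // => w /height_child ->; apply: delq.
(* The factor [q a (h c).+1] kills [del c], and also the sum over the siblings, by [sumq] at the
   parent. *)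
have gqS c : c != troot T -> g c *+ q a (h c).+1 = g (tparent c) *+ q a (h (tparent c)).
  move=> c0; have cp : c \in children (tparent c) by apply/childrenP.
  rewrite (gE _ _ cp) !mulrnDl delq addr0 -mulrnA mulnC mulrnA -(height_p c0).
  by rewrite sumq mul0rn addr0.
split=> v vl; first by move: vl; rewrite -height_0 => /eqP ->; rewrite q0 mulr0n.
(* At the root both sides are 0, since [q_n] kills [gam]. *)
have -> : to_tparent (fun v => g v *+ q a (h v)) v = g v *+ q a (h v).+1.
  rewrite /to_tparent; case: eqP => [->|/eqP v0]; last by rewrite gqS.
  by rewrite q_height_root g0 gamq.
have [k hv] : exists k, h v = k.+1.
  by move: vl; rewrite -height_0; case: (h v) => // k _; exists k.
(* With D the sum of the [del w], the corrections add up to D (a q_k + 1) = D q_{k+1} = 0. *)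
have -> : \sum_(c in children v) g c *+ q a (h c) = g v *+ (q a k * a).
  transitivity (\sum_(c in children v)
      (g v + (\sum_(w in children v) del w) *+ q a k + del c) *+ q a k).
    apply: eq_bigr => c cv; rewrite (gE _ _ cv).
    by move: (height_child cv); rewrite hv => -[->].
  rewrite sumrMnl !big_split /= !sumr_const card_children // -addrA -mulrnA.
  rewrite -{2}[\sum_(w in children v) del w]mulr1n -mulrnDr mulnC addnC -qS -hv.
  by rewrite sumq addr0 -mulrnA mulnC.
(* The identity (a+1) q_{k+1} = q_{k+2} + a q_k. *)
rewrite hv -mulrnA -mulrnDr !qS; congr (_ *+ _); nia.
Qed.

Lemma frame_of_harmonic (Z : zmodType) (x : tvertex T -> Z) :
  harmonic a x ->
  exists g : tvertex T -> Z,
    [/\ forall v, leaf v -> g v = x (tparent v),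
        forall v, ~~ leaf v -> g v = g (pref v) -
          (\sum_(c in children v) (g c - g (pref v))) *+ q a (h (pref v)),
        forall v, x v = g v *+ q a (h v)
      & frame (g (troot T))
          (fun c => if c == troot T then 0 else g c - g (pref (tparent c)))].
Proof.
move=> [xl xh].
(* The initial value at a leaf is forced by x_parent = q_1 G, as q_1 = 1. *)
have [|g [gl gn]] := @bottom_up Z (x \o @tparent T) (fun v g => g (pref v) -
          (\sum_(c in children v) (g c - g (pref v))) *+ q a (h (pref v))).
  move=> v g1 g2 vl g12; rewrite g12 ?pref_in //; congr (_ - _ *+ _).
  by apply: eq_bigr => c cv; rewrite g12.
(* Both identities are proved together by induction on the height: the second one at the children
   compares their [g] values. *)
have key v : x v = g v *+ q a (h v) /\ to_tparent x v = g v *+ q a (h v).+1.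
  have [k] := ubnP (h v); elim: k v => // k IHk v hvk.
  have [vl|vl] := boolP (leaf v).
    move: (vl); rewrite -height_0 => /eqP ->; rewrite q0 qS q0 muln0.
    by rewrite mulr0n xl // gl // /to_tparent (negbTE (leaf_nroot vl)).
  have [l hv] : exists l, h v = l.+1.
    by move: vl; rewrite -height_0; case: (h v) => // l _; exists l.
  have hc c : c \in children v -> h c = l.
    by move=> /height_child; rewrite hv => -[].
  have IHc c : c \in children v -> x c = g c *+ q a l /\ x v = g c *+ q a l.+1.
    move=> cv; have := IHk c; rewrite hc // => IH.
    have [|-> <-] := IH; first by rewrite hv in hvk.
    by case/childrenP: cv => c0 pc; rewrite /to_tparent (negbTE c0) pc.
  have [_ xv] := IHc _ (pref_in vl).
  set g1 := g (pref v) in xv *.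
  pose S := \sum_(c in children v) (g c - g1).
  have Sq : S *+ q a l.+1 = 0.
    rewrite -sumrMnl big1 // => c cv; rewrite mulrnBl -(IHc c cv).2.
    by rewrite -xv subrr.
  have gv : g v = g1 - S *+ q a l by rewrite gn // hc // pref_in.
  split.
    by rewrite hv gv mulrnBl -mulrnA mulnC mulrnA Sq mul0rn subr0.
  (* Adding the children's values lets harmonicity turn the left side into (a+1) x_v, a multiple of
     [g1]. *)
  apply: (addIr (\sum_(c in children v) x c)); rewrite -(xh v vl).
  have -> : \sum_(c in children v) x c = S *+ q a l + g1 *+ a *+ q a l.
    have <- : \sum_(c in children v) g1 = g1 *+ a.
      by rewrite sumr_const card_children.
    rewrite -mulrnDl -big_split /= -sumrMnl.
    by apply: eq_bigr => c cv; rewrite subrK (IHc c cv).1.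
  (* Since q_{l+2} = 1 + a q_{l+1} and q_{l+1} kills [S]. *)
  have Sq2 : S *+ q a l *+ q a l.+2 = S *+ q a l.
    by rewrite [q a l.+2]qS mulrnDr mulr1n mulnC mulrnA [S *+ _ *+ _]mulrnAC Sq !mul0rn addr0.
  rewrite hv gv mulrnBl Sq2 addrA subrK xv -!mulrnA -mulrnDr !qS.
  congr (_ *+ _); nia.
exists g; split=> //; first by move=> v; have [] := key v.
split.
- by rewrite -q_height_root -(key (troot T)).2 /to_tparent eqxx.
- move=> c; case: eqP => [_|/eqP c0]; first by rewrite mul0rn.
  have cp : c \in children (tparent c) by apply/childrenP.
  have pp := pref_in (tparent_nleaf c0).
  have e : h (pref (tparent c)) = h c.
    by apply/eqP; rewrite -eqSS -(height_child pp) -(height_child cp).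
  rewrite mulrnBl -{2}e -!(key _).2.
  case/childrenP: pp => p0 pp.
  by rewrite /to_tparent (negbTE c0) (negbTE p0) pp subrr.
- by rewrite eqxx.
- by move=> v /pref_in/childrenP[/negbTE-> ->]; rewrite subrr.
Qed.

(** The class of [v]; the search for an index fails exactly at the leaves. *)
Let x v : sandpile_group (sink T) :=
  if [pick i | index_vertex i == v] is Some i then coker_gen _ i else 0.

Let x_index i : x (index_vertex i) = coker_gen _ i.
Proof.
rewrite /x; case: pickP => [j /eqP/index_vertex_inj->//|/(_ i)].
by rewrite eqxx.
Qed.

Let x_leaf v : leaf v -> x v = 0.
Proof.
move=> vl; rewrite /x; case: pickP => // i /eqP iv.
by have := index_nleaf i; rewrite iv vl.
Qed.

Lemma sandpile_harmonic : harmonic a x.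
Proof.
split=> [//|v /index_vertexP[j <-]]; apply/esym/eqP; rewrite -subr_eq0.
rewrite -(sum_laplacian n_gt1 card_children) //.
by under eq_bigr do rewrite x_index; rewrite coker_relation.
Qed.

Lemma sandpile_lift (Z : zmodType) (y : tvertex T -> Z) :
  harmonic a y ->
  exists f : {additive sandpile_group (sink T) -> Z}, forall v, f (x v) = y v.
Proof.
move=> [yl yh]; have [|f fE] := @coker_lift _ _ (reduced_laplacian (sink T)) Z
  (y \o @index_vertex T).
  move=> j; rewrite (sum_laplacian n_gt1 card_children) // yh ?subrr //.
  exact: index_nleaf.
exists f => v; have [vl|/index_vertexP[i <-]] := boolP (leaf v).
  by rewrite x_leaf // raddf0 yl.
by rewrite x_index fE.
Qed.

(** * The sum of cyclic groups as the universal frame, and the isomorphism *)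

Section Target.
Variables (I : finType) (N ind : I -> nat) (idx : forall k, 'I_(N k) -> tvertex T).
Hypotheses (ind_gt1 : forall k, (1 < ind k)%N).
Hypotheses (idx_inj : forall k, injective (@idx k))
  (idx_secondary : forall k i, @idx k i \in secondary T n (ind k))
  (idx_surj : forall c j, (1 < j)%N -> c \in secondary T n j -> exists k i, c = @idx k i).
Hypothesis ind_inj : injective ind.
Let M : zmodType :=
  ('Z_(q a n) * {dffun forall k : I, {ffun 'I_(N k) -> 'Z_(q a (ind k))}})%type.

Let idx_height k i : (h (@idx k i)).+1 = ind k.
Proof. by have := idx_secondary i; rewrite inE => /and3P[_ _ /eqP]. Qed.

Let idx_disjoint k l (i : 'I_(N k)) (j : 'I_(N l)) : idx i = idx j -> k = l.
Proof. by move=> ij; apply: ind_inj; rewrite -(idx_height i) ij idx_height. Qed.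

Let gam : M := first_gen _ _ _.
Let del c : M := idx_gen _ _ idx c.

Lemma target_frame : frame gam del.
Proof.
split.
- by apply: first_gen_order; apply: q_gt1.
- by move=> c; apply: idx_gen_order => [k|k i <-]; rewrite ?q_gt1 ?idx_height.
- apply: idx_gen_eq0 => k i; have := idx_secondary i.
  by rewrite inE => /and3P[].
- move=> v /pref_in/childrenP[_ pv]; apply: idx_gen_eq0 => k i.
  have := idx_secondary i; rewrite inE => /and3P[_ + _].
  by apply: contraNneq => ->; rewrite pv.
Qed.

(** The universal property prescribes [f] on the named generators; at all other vertices both [del]
    and [z] vanish. *)
Lemma target_lift (Z : zmodType) (z0 : Z) (z : tvertex T -> Z) :
  frame z0 z -> exists f : {additive M -> Z}, f gam = z0 /\ forall c, f (del c) = z c.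
Proof.
move=> fr; have [z0q zq zr zp] := fr.
have zQ k (i : 'I_(N k)) : z (idx i) *+ q a (ind k) = 0 by rewrite -(idx_height i).
have [||f [f0 fE]] := cyclic_sum_lift _ _ idx_inj idx_disjoint z0q zQ.
- exact: q_gt1.
- by move=> k; apply: q_gt1.
exists f; split=> // c; have [_ _ delr delp] := target_frame.
(* Leaves are set apart because a non-preferred leaf lies in [secondary T n 1], which [idx_surj]
   does not cover. *)
have [c_leaf|c_nleaf] := boolP (leaf c).
  by rewrite (frame_leaf target_frame c_leaf) (frame_leaf fr c_leaf) raddf0.
have [c_sec|] := boolP (c \in secondary T n (h c).+1).
  have [|k [i ->]] := idx_surj _ c_sec; last exact: fE.
  by rewrite ltnS lt0n height_0.
rewrite inE eqxx andbT negb_and !negbK => /orP[/eqP->|/eqP cp].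
  by rewrite delr zr raddf0.
have [->|c0] := eqVneq c (troot T); first by rewrite delr zr raddf0.
by rewrite cp delp ?zp ?raddf0 // tparent_nleaf.
Qed.

(** [phi] comes from the harmonic function built on the target, [psi] from the frame built in the
    sandpile group. They exchange [g] and [G], so both composites fix the generators. *)
Lemma sandpile_split : zmod_isomorphic (sandpile_group (sink T)) M.
Proof.
have [g [g0 gc gh]] := harmonic_of_frame target_frame.
have [phi phiE] := sandpile_lift gh.
have [G [Gl Gn xG fr]] := frame_of_harmonic sandpile_harmonic.
have [psi [psi0 psiE]] := target_lift fr.
have sib v c : c \in children v -> ~~ leaf v /\ h (pref v) = h c.
  move=> cv; have vl : ~~ leaf v by apply/set0Pn; exists c.
  split=> //; apply/eqP.
  by rewrite -eqSS -(height_child cv) -(height_child (pref_in vl)).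
(* By induction on the depth, as [g] is determined downwards. *)
have psi_g v : psi (g v) = G v.
  have [k] := ubnP (depth v); elim: k v => // k IHk c dc.
  have [->|c0] := eqVneq c (troot T); first by rewrite g0.
  have cv : c \in children (tparent c) by apply/childrenP.
  have [vl hp] := sib _ _ cv.
  have psi_sum : psi (\sum_(w in children (tparent c)) del w) =
      \sum_(w in children (tparent c)) (G w - G (pref (tparent c))).
    rewrite raddf_sum; apply: eq_bigr => w /childrenP[w0 pw].
    by rewrite psiE (negbTE w0) pw.
  rewrite (gc _ _ cv) !raddfD raddfMn psi_sum IHk; last first.
    by move: dc; rewrite (depth_tparent c0).
  by rewrite psiE (negbTE c0) (Gn _ vl) hp subrK addrCA subrr addr0.
(* By induction on the height, as [G] is determined upwards. *)
have phi_G v : phi (G v) = g v.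
  have [k] := ubnP (h v); elim: k v => // k IHk v hv.
  have [vl|vl] := boolP (leaf v).
    have v0 := leaf_nroot vl; have vp : v \in children (tparent v) by apply/childrenP.
    rewrite Gl // phiE height_p // (gc _ _ vp) (frame_leaf target_frame vl) addr0.
    by move: (vl); rewrite -height_0 => /eqP ->; rewrite qS q0 muln0 mulr1n addr0.
  have IHc c : c \in children v -> phi (G c) = g c.
    by move=> cv; apply: IHk; rewrite (height_child cv) in hv.
  have pv := pref_in vl; have [_ _ _ delp] := target_frame.
  have phi_sum : phi (\sum_(w in children v) (G w - G (pref v))) =
      \sum_(w in children v) del w.
    rewrite raddf_sum; apply: eq_bigr => w wv; rewrite raddfB !IHc //.
    (* Siblings have equal heights, so their corrections cancel and only [del w] remains. *)
    rewrite (gc _ _ wv) (gc _ _ pv) (sib _ _ wv).2 delp // addr0.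
    by rewrite addrAC subrr add0r.
  rewrite Gn // raddfB raddfMn phi_sum IHc // (gc _ _ pv) delp // addr0.
  by rewrite addrK.
exists phi; exists psi.
  move=> y; apply: (coker_eq_additive (f := psi \o phi) (g := idfun)) => i /=.
  by rewrite -x_index phiE raddfMn psi_g -xG.
move=> y; apply: (cyclic_sum_eq_additive idx_inj idx_disjoint
  (f := phi \o psi) (g := idfun)) => [|k i] /=.
  by rewrite psi0 phi_G g0.
have := idx_secondary i; rewrite inE => /and3P[c0 _ _].
have cv : idx i \in children (tparent (idx i)) by apply/childrenP.
have [vl hp] := sib _ _ cv; have [_ _ _ delp] := target_frame.
rewrite -/(del _) psiE (negbTE c0) raddfB !phi_G (gc _ _ cv) (gc _ _ (pref_in vl)).
by rewrite hp delp // addr0 addrAC subrr add0r.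
Qed.
End Target.
End Splitting.

(** * Numbering the cyclic summands by non-preferred vertices *)

Theorem theorem1p2 (d n : nat) (T : rooted_tree)
    (hd : 3 <= d) (hn : 2 <= n) (hT : regular_tree d n T) :
  let a := d - 1 in
  zmod_isomorphic
    (sandpile_group (sink T))
    ('Z_(q a n) *
     {dffun forall k : {k : 'I_n | 2 <= k},
        {ffun 'I_(a ^ (n - 1 - val k) * (a - 1)) -> 'Z_(q a (val k))}})%type.
Proof.
move=> a; case: hT => card_ch depth_lf.
have a_gt0 : 0 < a by rewrite subn_gt0 ltnW.
have cardS (k : {k : 'I_n | 2 <= k}) :
    #|secondary T n (val k)| = a ^ (n - 1 - val k) * (a - 1).
  by apply: card_secondary => //; rewrite (valP k) ltn_ord.
(* The copies of [Z/q_k] are named by an enumeration of [secondary T n k], cast along its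
   cardinality. *)
apply: (@sandpile_split T a n a_gt0 hn card_ch depth_lf _ _
  (fun k => val (val k)) (fun k i => enum_val (cast_ord (esym (cardS k)) i))).
- by move=> k; exact: (valP k).
- by move=> k i j /enum_val_inj/cast_ord_inj.
- by move=> k i; exact: enum_valP.
- move=> c j j2 c_in; have lt_jn : j < n.
    (* A vertex other than the root has height at most [n - 2]. *)
    move: c_in; rewrite inE /height -depth_eq0 => /and3P[c0 _ /eqP <-]; lia.
  pose k : {k : 'I_n | 2 <= k} := Sub (Ordinal lt_jn) j2.
  exists k, (cast_ord (cardS k) (enum_rank_in (A := secondary T n (val k)) c_in c)).
  by rewrite cast_ordK enum_rankK_in.
- by move=> k l /val_inj/val_inj.
Qed.
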